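(* Let $(T,X,\pi)$ be a topological flow on a Polish space $X$ with $T$ an abelian topological group. If $(T,X,\pi)$ is Devaney chaotic, then it is multi-dimensional chaotic.
   Context: A topological flow $(T,X,\pi)$ consists of a topological group $T$ (not necessarily discrete), a topological space $X$ and a jointly continuous action $\pi\colon T\times X\to X$, $(t,x)\mapsto tx$, with $s(tx)=(st)x$ and $ex=x$, where $e$ is the neutral element. $T$ acts on $X^k$ by $t(x_1,\dots,x_k)=(tx_1,\dots,tx_k)$. $Tx=\{tx : t\in T\}$ and $t^{-1}V=\{x : tx\in V\}$. A subset $B\subseteq T$ is syndetic if there is a compact $K\subseteq T$ with $Kt\cap B\neq\emptyset$ for all $t\in T$. A point $x$ is periodic if $\{t\in T : tx=x\}$ is syndetic in $T$. $(T,X,\pi)$ is Devaney chaotic if (1) it is topologically transitive, i.e. for all nonempty open $U,V\subseteq X$ there is $t\in T$ with $U\cap t^{-1}V\neq\emptyset$; (2) its periodic points are dense in $X$; (3) it is not minimal, where minimal means $\overline{Tx}=X$ for every $x\in X$. $(T,X,\pi)$ is multi-dimensional chaotic if for every increasing sequence $\{F_n\}_{n\ge1}$ of compact subsets of $T$ there is an infinite set $\Theta\subseteq X$ such that for any $k\ge2$ and any distinct $x_1,\dots,x_k\in\Theta$ there are sequences $\{s_n\},\{t_n\}$ in $T$ and a point $p\in X$ with $s_n\notin F_n$ for all $n$, $s_n(x_1,\dots,x_k)\to(x_1,\dots,x_k)$ and $t_n(x_1,\dots,x_k)\to(p,\dots,p)$ as $n\to\infty$. *)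

(* Defs.v *)
From HB Require Import structures.
From mathcomp Require Import all_boot all_order all_algebra.
From mathcomp Require Import all_classical all_reals.
From mathcomp Require Import topology.
Set Implicit Arguments.
Unset Strict Implicit.
Unset Printing Implicit Defensive.

Import Order.TTheory GRing.Theory Num.Theory.

Local Open Scope classical_set_scope.

(* Neither commutativity nor the Hausdorff property is assumed. *)
HB.mixin Record isTopologicalGroup T of Topological T & Group T := {
  mulg_continuous : continuous (fun z : T * T => (z.1 * z.2)%g) ;
  invg_continuous : continuous (fun t : T => (t^-1)%g)
}.

#[short(type="topologicalGroupType")]
HB.structure Definition TopologicalGroup :=
  {T of Topological T & Group T & isTopologicalGroup T}.

Record topological_flow (T : topologicalGroupType) (X : topologicalType) := {
  flow_act :> T -> X -> X ;
  flow_continuous : continuous (fun z : T * X => flow_act z.1 z.2) ;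
  flow_actM : forall s t x, flow_act s (flow_act t x) = flow_act (s * t)%g x ;
  flow_act1 : forall x, flow_act 1%g x = x
}.

Section PolishSpace.
Local Open Scope ring_scope.

Definition is_metric (R : realType) (X : Type) (d : X -> X -> R) : Prop :=
  [/\ forall x y, (d x y = 0) <-> (x = y),
      forall x y, d x y = d y x &
      forall x y z, d x z <= d x y + d y z].

Definition metric_compatible (R : realType) (X : topologicalType)
    (d : X -> X -> R) : Prop :=
  forall (x : X) (A : set X),
    nbhs x A <-> exists2 e : R, 0 < e & [set y | d x y < e] `<=` A.

Definition metric_complete (R : realType) (X : topologicalType)
    (d : X -> X -> R) : Prop :=
  forall u : nat -> X,
    (forall e : R, 0 < e ->
      exists N : nat, forall m n, (N <= m)%N -> (N <= n)%N -> d (u m) (u n) < e) ->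
    exists l : X, u @ \oo --> l.

Definition separable_space (X : topologicalType) : Prop :=
  exists2 S : set X, countable S & dense S.

Definition polish_space (R : realType) (X : topologicalType) : Prop :=
  separable_space X /\
  exists d : X -> X -> R,
    [/\ is_metric d, metric_compatible d & metric_complete d].

End PolishSpace.

Definition syndetic (T : topologicalGroupType) (B : set T) : Prop :=
  exists2 K : set T, compact K &
    forall t : T, [set (k * t)%g | k in K] `&` B !=set0.

Section FlowDynamics.
Variables (T : topologicalGroupType) (X : topologicalType).
Variable pi : topological_flow T X.

Definition flow_orbit (x : X) : set X := range (fun t : T => pi t x).

Definition periodic_point (x : X) : Prop := syndetic [set t : T | pi t x = x].

Definition topologically_transitive : Prop :=
  forall U V : set X, open U -> open V -> U !=set0 -> V !=set0 ->
    exists t : T, U `&` (pi t @^-1` V) !=set0.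

Definition minimal_flow : Prop :=
  forall x : X, closure (flow_orbit x) = [set: X].

Definition devaney_chaotic : Prop :=
  [/\ topologically_transitive,
      dense [set x : X | periodic_point x] &
      ~ minimal_flow].

(* X^k carries the product topology. *)
Definition power_act (k : nat) (t : T) (x : {ptws 'I_k -> X}) :
    {ptws 'I_k -> X} := fun i => pi t (x i).

(* "Increasing" is read non-strictly, and sequences start at index 0. *)
Definition multi_dimensional_chaotic : Prop :=
  forall F : nat -> set T,
    (forall n, compact (F n)) ->
    (forall n, F n `<=` F n.+1) ->
    exists2 Theta : set X, infinite_set Theta &
      forall (k : nat) (x : {ptws 'I_k -> X}),
        (2 <= k)%N -> (forall i, Theta (x i)) -> injective x ->
        exists (s t : nat -> T) (p : X),
          [/\ forall n, ~ F n (s n),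
              (fun n => power_act (s n) x) @ \oo --> x &
              (fun n => power_act (t n) x) @ \oo -->
                ((fun=> p) : {ptws 'I_k -> X})].

End FlowDynamics.

(* Main.v *)
Require Import Defs.
From mathcomp Require Import all_boot all_order all_algebra.
From mathcomp Require Import all_classical all_reals.
From mathcomp Require Import topology.
From mathcomp Require Import lra.

(** Fix a point [x] with dense orbit, which exists by Baire's theorem
([exists_dense_orbit]), and a periodic point [q] with stabilizer [S]. The set
Theta is the [S]-orbit of [x], whatever the compact sets [F n] are.

Collapse. As [S] is syndetic, [T] is covered by the translates of [S] by a
compact set, so the density of the [T]-orbit of [x] is inherited by its
[S]-orbit up to a translation: some [p = k q] lies in the closure of [S x]
([syndetic_orbit_closure]). Commutativity makes [S] fix [k q] as well. If
[t_n x] tends to [p], then for every [s] in [S]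
  [t_n (s x) = s (t_n x)] tends to [s p = p],
so a single sequence brings all the points of Theta to [p] at once.

Recurrence. In the same way, if [r_n x] tends to [x] then [r_n (s x)] tends to
[s x] for all [s], so it is enough to find [r_n] outside [F n] with [r_n x]
near [x]. If there were none, a neighbourhood of [x] would be contained in the
compact set [F n x]; the periodic point found in it would then have the same
orbit as [x] ([recurrent_outside_compact]).

Both the infinitude of Theta and the last contradiction come from one fact: a
dense orbit that is compact is the whole space, so the flow would be minimal
([compact_dense_orbit_minimal]). Orbits of periodic points are compact, and so
would be the [T]-orbit of [x] if [S x] were finite ([compact_orbit]). *)

Import Order.TTheory GRing.Theory Num.Theory.
Local Open Scope classical_set_scope.

(** * Complete metrics and Baire's theorem *)

Section MetrizableSpace.
Local Open Scope ring_scope.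
Context {R : realType} {X : topologicalType} (d : X -> X -> R).
Hypotheses (d_metric : is_metric d) (d_compat : metric_compatible d).

Let d_eq0 x y : d x y = 0 <-> x = y. Proof. by have [] := d_metric. Qed.
Let d_sym x y : d x y = d y x. Proof. by have [] := d_metric. Qed.
Let d_tri x y z : d x z <= d x y + d y z. Proof. by have [] := d_metric. Qed.
Let dxx x : d x x = 0. Proof. exact/d_eq0. Qed.

Lemma metric_ge0 x y : 0 <= d x y.
Proof. have := d_tri x y x; rewrite dxx (d_sym y x); lra. Qed.

Lemma nbhs_metric_ball x (e : R) : 0 < e -> nbhs x [set y | d x y < e].
Proof. by move=> e0; apply/d_compat; exists e. Qed.

Lemma open_metric_ball x (e : R) : open [set y | d x y < e].
Proof.
rewrite openE => y /= xye; apply/d_compat; exists (e - d x y); first by lra.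
by move=> z /= yz; have := d_tri x y z; lra.
Qed.

Lemma metric_hausdorff : hausdorff_space X.
Proof.
move=> x y xy; apply/d_eq0/eqP; rewrite eq_le metric_ge0 andbT leNgt.
apply/negP => xy0; have e0 : 0 < d x y / 2 by lra.
have [z [/= xz yz]] := xy _ _ (nbhs_metric_ball x _ e0) (nbhs_metric_ball y _ e0).
by have := d_tri x z y; rewrite (d_sym z y); lra.
Qed.

Lemma cvg_metric_inv (u : nat -> X) l :
  (forall n, d l (u n) < n.+1%:R^-1) -> u @ \oo --> l.
Proof.
move=> ul A /d_compat[e e0 eA].
have [N] := ltr_add_invr e0; rewrite add0r => Ne.
exists N => // n /= Nn; apply: eA => /=; apply: lt_trans Ne.
apply: lt_le_trans (ul n) _.
by rewrite lef_pV2 ?posrE// ler_nat ltnS.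
Qed.

(** The index sets [A n] may depend on [n]: recurrence uses the complements of
an increasing sequence of compact sets. *)
Lemma closure_cvg_metric (I : Type) (A : nat -> set I) (f : I -> X) l :
  (forall n, closure (f @` A n) l) ->
  exists2 s : nat -> I, (forall n, A n (s n)) & (fun n => f (s n)) @ \oo --> l.
Proof.
move=> Al; have /choice[s sP] (n : nat) :
    exists i, A n i /\ d l (f i) < n.+1%:R^-1.
  have n0 : 0 < n.+1%:R^-1 :> R by rewrite invr_gt0.
  by have [_ [[i Ai <-] di]] := Al n _ (nbhs_metric_ball l _ n0); exists i.
exists s => [n|]; first by have [] := sP n.
by apply: cvg_metric_inv => n; have [] := sP n.
Qed.

(** The usual nested balls: the state [(c, r)] of the construction stands for
the closed ball of centre [c] and radius [r], and each step shrinks it into the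
previous open ball and into the next dense open set. The centres form a Cauchy
sequence, whose limit lies in all the closed balls. *)
Lemma baire_metric (G : nat -> set X) : metric_complete d -> [set: X] !=set0 ->
  (forall n, open (G n)) -> (forall n, dense (G n)) ->
  \bigcap_n G n !=set0.
Proof.
move=> d_complete [x0 _] oG dG.
have shrink (ncr : nat * (X * R)) : exists cr : X * R, 0 < ncr.2.2 ->
    [/\ 0 < cr.2, cr.2 < ncr.1.+1%:R^-1 &
        forall y, d cr.1 y <= cr.2 -> G ncr.1 y /\ d ncr.2.1 y < ncr.2.2].
  case: ncr => n [c r] /=; have [r0|] := ltP 0 r; last by exists (c, r).
  have ball0 : [set y | d c y < r] !=set0 by exists c => /=; rewrite dxx.
  have [c' [cc' Gc']] := dG n _ ball0 (open_metric_ball c r).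
  have : nbhs c' ([set y | d c y < r] `&` G n).
    apply: filterI; first exact: open_nbhs_nbhs (conj (open_metric_ball c r) cc').
    exact: open_nbhs_nbhs (conj (oG n) Gc').
  move=> /d_compat[e e0 eG].
  have n0 : 0 < n.+1%:R^-1 :> R by rewrite invr_gt0.
  have m0 : 0 < Num.min e n.+1%:R^-1 by rewrite lt_min e0.
  have : Num.min e n.+1%:R^-1 <= e by rewrite ge_min lexx.
  have : Num.min e n.+1%:R^-1 <= n.+1%:R^-1 by rewrite ge_min lexx orbT.
  move: (Num.min _ _) m0 => m m0 mn me.
  (* Half of the admissible radius, so that the closed ball fits. *)
  exists (c', m / 2) => _ /=; split; [lra|by apply: lt_le_trans mn; lra|move=> y c'y].
  have /eG[] // : d c' y < e by lra.
have [next nextP] := choice shrink.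
pose u := fix u n := if n is m.+1 then next (m, u m) else (x0, 1 : R).
have u0 n : 0 < (u n).2.
  by elim: n => [|n IH] /=; [exact: ltr01|have [] := nextP (n, u n) IH].
have uG n y : d (u n.+1).1 y <= (u n.+1).2 -> G n y /\ d (u n).1 y < (u n).2.
  by have [_ _] := nextP (n, u n) (u0 n); apply.
have nested n m y : (n <= m)%N -> d (u m).1 y <= (u m).2 -> d (u n).1 y <= (u n).2.
  move=> /subnK <-; elim: (m - n)%N => [//|k IH] uy.
  by apply/IH/ltW; have [] := uG _ _ uy.
have center n m : (n <= m)%N -> d (u n).1 (u m).1 <= (u n).2.
  by move=> nm; apply: (nested n m) => //; rewrite dxx ltW.
have [|l ul] := d_complete (fun n => (u n).1).
  move=> e e0; have e20 : 0 < e / 2 by lra.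
  have [N] := ltr_add_invr e20; rewrite add0r => Ne.
  exists N.+1 => m n Nm Nn.
  have rN : (u N.+1).2 < e / 2.
    by apply: lt_trans Ne; have [] := nextP (N, u N) (u0 N).
  have := center _ _ Nm; have := center _ _ Nn.
  have := d_tri (u m).1 (u N.+1).1 (u n).1.
  by rewrite (d_sym (u m).1 (u N.+1).1); lra.
exists l => n _; apply: (proj1 (uG n l _)); rewrite leNgt; apply/negP => lfar.
have e0 : 0 < d (u n.+1).1 l - (u n.+1).2 by lra.
have [N _ Nl] := ul _ (nbhs_metric_ball l _ e0).
have /= := Nl (maxn N n.+1) (leq_maxl _ _).
have := center n.+1 (maxn N n.+1) (leq_maxr _ _).
have := d_tri (u n.+1).1 (u (maxn N n.+1)).1 l.
rewrite (d_sym l); lra.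
Qed.

End MetrizableSpace.

(** Coordinatewise convergence over an arbitrary topological space, which need
not carry a uniform structure. *)
Lemma ptws_cvg {I : choiceType} {X : topologicalType}
    (u : nat -> {ptws I -> X}) (x : {ptws I -> X}) :
  (forall i, (fun n => u n i) @ \oo --> x i) -> u @ \oo --> x.
Proof.
move=> ux; apply/cvg_sup => i A.
have /= -> := @nbhsE (initial_topology (fun f : I -> X => f i)) x.
case=> B [[C oC <-] Cx] /filterS; apply; apply: (ux i).
exact: open_nbhs_nbhs.
Qed.

(** * Orbits of a topological flow *)

Section Flow.
Context {T : topologicalGroupType} {X : topologicalType}.
Variable pi : topological_flow T X.

Definition stabilizer (x : X) : set T := [set t | pi t x = x].

Lemma flow_act_continuous t : continuous (pi t).
Proof.
move=> x; apply: (@continuous_comp _ _ _ (fun x => (t, x)) (fun z => pi z.1 z.2)).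
  by apply: cvg_pair; [exact: cvg_cst|exact: cvg_id].
exact: flow_continuous.
Qed.

Lemma orbit_map_continuous x : continuous (pi ^~ x).
Proof.
move=> t; apply: (@continuous_comp _ _ _ (fun t => (t, x)) (fun z => pi z.1 z.2)).
  by apply: cvg_pair; [exact: cvg_id|exact: cvg_cst].
exact: flow_continuous.
Qed.

Lemma flow_actK t : cancel (pi t) (pi t^-1%g).
Proof. by move=> x; rewrite flow_actM mulVg flow_act1. Qed.

Lemma flow_orbit_act t x : flow_orbit pi (pi t x) = flow_orbit pi x.
Proof.
apply/seteqP; split=> _ [s _ <-].
  by exists (s * t)%g => //; rewrite flow_actM.
by exists (s * t^-1)%g => //; rewrite -flow_actM flow_actK.
Qed.

(** If [K] is compact and [K t] meets [S] for all [t], then every [t] is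
[k^-1 s] for some [k] in [K] and [s] in [S]; hence the orbit of [x] is the image
of [K * S x] under the continuous map [(k, y) |-> k^-1 y]. *)
Lemma compact_orbit (S : set T) x : syndetic S -> compact [set pi s x | s in S] ->
  compact (flow_orbit pi x).
Proof.
move=> [K cK KS] cSx.
pose f (z : T * X) := pi z.1^-1%g z.2.
suff -> : flow_orbit pi x = f @` (K `*` [set pi s x | s in S]).
  apply: continuous_compact; last exact: compact_setX.
  apply: continuous_subspaceT => z.
  apply: (@continuous_comp _ _ _ (fun z : T * X => (z.1^-1%g, z.2))
    (fun z => pi z.1 z.2)); last exact: flow_continuous.
  apply: cvg_pair => /=; last exact: cvg_snd.
  exact: (continuous_comp (@cvg_fst _ _ _ _ _) (@invg_continuous T z.1)).
apply/seteqP; split=> [_ [t _ <-]|_ [[k _] [/= Kk [s Ss <-]] <-]]; last first.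
  by exists (k^-1 * s)%g => //; rewrite /f /= flow_actM.
have [_ [[k Kk <-] Skt]] := KS t.
exists (k, pi (k * t)%g x); first by split=> //; exists (k * t)%g.
by rewrite /f/= flow_actM mulgA mulVg mul1g.
Qed.

Lemma periodic_compact_orbit q : periodic_point pi q -> compact (flow_orbit pi q).
Proof.
move=> /compact_orbit; apply; apply: finite_compact.
by apply: (@sub_finite_set _ _ [set q]) => // _ [t tq <-].
Qed.

Lemma closure_orbitT x : dense (flow_orbit pi x) -> closure (flow_orbit pi x) = setT.
Proof.
move=> Tx_dense; apply/seteqP; split=> // y _ B.
rewrite nbhsE => -[O [oO Oy] OB]; have [z [Oz Txz]] := Tx_dense O (ex_intro _ y Oy) oO.
by exists z; split=> //; exact: OB.
Qed.

(** A compact orbit is closed, so a dense one is the whole space; then every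
point has that same orbit. *)
Lemma compact_dense_orbit_minimal x : hausdorff_space X ->
  dense (flow_orbit pi x) -> compact (flow_orbit pi x) -> minimal_flow pi.
Proof.
move=> X_haus Tx_dense /(compact_closed X_haus)/closure_id Tx_closed y.
have : flow_orbit pi x y by rewrite Tx_closed closure_orbitT.
by case=> t _ <-; rewrite flow_orbit_act closure_orbitT.
Qed.

(** If [x] returned to some neighbourhood [U] of itself only at times of [F],
density would give that [U] is in the closure of [F x], which is [F x] by
compactness. A periodic point in [U] would then lie on the orbit of [x] and
make it compact. *)
Lemma recurrent_outside_compact x (F : set T) : hausdorff_space X ->
  dense [set q | periodic_point pi q] -> ~ minimal_flow pi ->
  dense (flow_orbit pi x) -> compact F -> closure [set pi t x | t in ~` F] x.
Proof.
move=> X_haus per_dense not_min Tx_dense F_compact B.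
rewrite nbhsE => -[U [oU Ux] UB]; apply: contrapT => noret.
have UF : U `<=` [set pi t x | t in F].
  move=> y Uy; have : closed [set pi t x | t in F].
    apply: compact_closed X_haus _; apply: continuous_compact F_compact.
    exact/continuous_subspaceT/orbit_map_continuous.
  apply=> W; rewrite nbhsE => -[V [oV Vy] VW].
  have [|z [[Vz Uz] [t _ tz]]] := Tx_dense (V `&` U) _ (openI oV oU).
    by exists y.
  exists (pi t x); rewrite tz; split; last exact: VW.
  exists t => //; apply: contrapT => nFt; apply: noret.
  by exists (pi t x); split; [exists t|rewrite tz; exact: UB].
have [q [/UF[t _ <-] /periodic_compact_orbit]] := per_dense U (ex_intro _ x Ux) oU.
rewrite flow_orbit_act => Tx_compact.
exact/not_min/(compact_dense_orbit_minimal _ X_haus Tx_dense).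
Qed.

Lemma infinite_syndetic_orbit x (S : set T) : hausdorff_space X ->
  ~ minimal_flow pi -> dense (flow_orbit pi x) -> syndetic S ->
  infinite_set [set pi s x | s in S].
Proof.
move=> X_haus not_min Tx_dense S_synd /finite_compact Sx_compact.
apply/not_min/(compact_dense_orbit_minimal _ X_haus Tx_dense).
exact: compact_orbit S_synd Sx_compact.
Qed.

(** Otherwise, each [k] in the compact set [K] of the syndetic set [S] has
neighbourhoods of [k] and of [q] whose product misses [S x]. By compactness some
neighbourhood of [q] is kept away from [S x] by all of [K]; but that
neighbourhood contains a point [t x], and [k t] is in [S] for some [k] in
[K]. *)
Lemma syndetic_orbit_closure x q (S : set T) :
  dense (flow_orbit pi x) -> syndetic S ->
  exists k, closure [set pi s x | s in S] (pi k q).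
Proof.
move=> Tx_dense [K /compact_near_coveringP K_compact KS].
apply: contrapT => /forallNP noclose.
have missing : \forall y \near q,
    K `<=` [set k | ~ [set pi s x | s in S] (pi k y)].
  apply: (K_compact X (nbhs q)
    (fun y k => ~ [set pi s x | s in S] (pi k y))) => k _.
  have /existsNP[W /not_implyP[Wkq disj]] := noclose k.
  have nearW := @flow_continuous _ _ pi (k, q) _ Wkq.
  apply: (@filterS _ (nbhs (k, q)) _ _ _ _ nearW) => -[k' y] /= Wy Sx.
  by apply: disj; exists (pi k' y).
have : closure (flow_orbit pi x) q by rewrite closure_orbitT.
move=> /(_ _ missing)[_ [[t _ <-] missing_t]].
have [_ [[k Kk <-] Skt]] := KS t.
by apply: (missing_t k Kk); exists (k * t)%g; rewrite // flow_actM.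
Qed.

Lemma stabilizer_act q k : (forall s t : T, commute s t) ->
  forall s, stabilizer q s -> pi s (pi k q) = pi k q.
Proof. by move=> comm s sq; rewrite flow_actM comm -flow_actM sq. Qed.

End Flow.

(** * Points with dense orbit and chaos *)

(** The dense orbits are those that hit all the balls of radius [1/(n+1)]
centred at the points of a countable dense set; transitivity says that hitting
one such ball is a dense condition, so Baire's theorem applies. *)
Lemma exists_dense_orbit {R : realType} {T : topologicalGroupType}
    {X : topologicalType} (pi : topological_flow T X) :
  polish_space R X -> topologically_transitive pi -> [set: X] !=set0 ->
  exists x, dense (flow_orbit pi x).
Proof.
move=> [[A A_count A_dense] [d [d_metric d_compat d_complete]]] trans X0.
pose V (an : X * nat) := [set y | (d an.1 y < an.2.+1%:R^-1)%R].
have V0 an : V an !=set0.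
  have [d_eq0 _ _] := d_metric; exists an.1.
  by rewrite /V /= (proj2 (d_eq0 _ _) erefl) invr_gt0.
have oV an : open (V an) by exact: open_metric_ball.
pose hits an := \bigcup_t (pi t @^-1` V an).
have o_hits an : open (hits an).
  apply: bigcup_open => t _; apply: open_comp (oV an) => y _.
  exact: flow_act_continuous.
have hits_dense an : dense (hits an).
  move=> U U0 oU; have [t [y [Uy Vy]]] := trans U (V an) oU (oV an) U0 (V0 an).
  by exists y; split=> //; exists t.
have : countable (A `*` [set: nat]) by exact: countableX.
move=> /pfcard_geP[A0|[e]].
  have [x _] := X0; have [a [_ Aa]] := A_dense setT X0 openT.
  by have : (A `*` [set: nat]) (a, 0%N) by []; rewrite A0.
have [x xhits] := baire_metric _ d_metric d_compat (fun n => hits (e n))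
  d_complete X0 (fun n => o_hits _) (fun n => hits_dense _).
exists x => O [y Oy] oO.
have /d_compat[r r0 rO] : nbhs y O by exact: open_nbhs_nbhs.
have r20 : (0 < r / 2)%R by lra.
(* A ball of radius less than [r / 2] centred within [r / 2] of [y] lies in the
   ball of radius [r] about [y]. *)
have [n] := ltr_add_invr r20; rewrite add0r => nr.
have [a [ya Aa]] : V (y, n) `&` A !=set0 by exact: A_dense.
have [m _ em] : (e @` setT) (a, n) by apply: surj; split.
have [t _ at_] := xhits m Logic.I; exists (pi t x); split; last by exists t.
apply: rO => /=; rewrite em /V /= in ya at_.
have [_ _ d_tri] := d_metric; apply: le_lt_trans (d_tri y a _) _.
have : (d y a < r / 2)%R by exact: lt_trans nr.
have : (d a (pi t x) < r / 2)%R by exact: lt_trans nr.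
lra.
Qed.

Theorem corollary2p16 (R : realType) (T : topologicalGroupType)
    (X : topologicalType) (pi : topological_flow T X)
    (X_polish : polish_space R X)
    (T_abelian : forall s t : T, commute s t)
    (pi_devaney : devaney_chaotic pi) :
  multi_dimensional_chaotic pi.
Proof.
have [trans per_dense not_min] := pi_devaney.
have [_ [d [d_metric d_compat _]]] := X_polish.
have X_haus := metric_hausdorff d d_metric d_compat.
have X0 : [set: X] !=set0.
  by have /existsNP[x _] := not_min; exists x.
have [x Tx_dense] := exists_dense_orbit pi X_polish trans X0.
have [q [_ q_per]] := per_dense setT X0 openT.
pose S := stabilizer pi q.
have [k close_kq] := syndetic_orbit_closure pi x q S Tx_dense q_per.
have [t tS tx] := closure_cvg_metric d d_compat T (fun=> S) (pi ^~ x) _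
  (fun=> close_kq).
move=> F F_compact _; exists [set pi s x | s in S].
  exact: infinite_syndetic_orbit.
have [r rF rx] := closure_cvg_metric d d_compat T (fun n => ~` F n) (pi ^~ x) x
  (fun n => recurrent_outside_compact pi x _ X_haus per_dense not_min Tx_dense
    (F_compact n)).
move=> m y _ yS _; exists r, t, (pi k q); split=> //; apply: ptws_cvg => i.
  have [s _ sx] := yS i; rewrite /power_act -sx.
  under eq_fun do rewrite flow_actM T_abelian -flow_actM.
  exact: (continuous_cvg _ (flow_act_continuous pi s x) rx).
have [s Ss sx] := yS i; rewrite /power_act -sx.
under eq_fun do rewrite flow_actM T_abelian -flow_actM.
rewrite -(stabilizer_act pi q k T_abelian s Ss).
exact: (continuous_cvg _ (flow_act_continuous pi s _) tx).
Qed.
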